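(* Let $E$ and $F$ be Banach lattices with $F$ Dedekind complete, and let $T:E\to F$ be a positive operator. Then $T$ is almost order-weakly compact if and only if for each disjoint almost order bounded sequence $\{x_n\}$ in $E$ one has $\|T(x_n)\|\to 0$ in $F$.
   Context: Let $E$ be a Banach lattice with closed unit ball $B_E$. A subset $A\subseteq E$ is almost order bounded if for every $\epsilon>0$ there exists $u\in E^+$ such that $A\subseteq [-u,u]+\epsilon B_E$. A sequence is almost order bounded if its set of terms is. A continuous (linear) operator $T:E\to F$ between Banach lattices is almost order-weakly compact if it maps every almost order bounded subset of $E$ onto a relatively weakly compact subset of $F$. A sequence $\{x_n\}$ is disjoint if $|x_n|\wedge|x_m|=0$ for $n\neq m$. *)

(* Defs.v *)
From HB Require Import structures.
From mathcomp Require Import all_boot all_order all_algebra.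
From mathcomp Require Import all_classical all_reals all_analysis.
Set Implicit Arguments.
Unset Strict Implicit.
Unset Printing Implicit Defensive.
Import Order.TTheory GRing.Theory Num.Theory.
Import numFieldNormedType.Exports.
Local Open Scope classical_set_scope.
Local Open Scope ring_scope.

Reserved Notation "x <=v y" (at level 70, y at next level).

(* The order is a field of the mixin instead of an [Order.Lattice] parent:
   Hierarchy-Builder admits no structure above both [NormedModule] and
   [Order.Preorder] that is declared after [numDomainType]. *)
HB.mixin Record isBanachLattice (R : realType) V
    & CompleteNormedModule R V := {
  vle : rel V;
  vjoin : V -> V -> V;
  vmeet : V -> V -> V;
  vle_refl : reflexive vle;
  vle_anti : antisymmetric vle;
  vle_trans : transitive vle;
  vle_join : forall x y z : V, vle (vjoin x y) z = vle x z && vle y z;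
  vle_meet : forall x y z : V, vle x (vmeet y z) = vle x y && vle x z;
  vleD2r : forall z x y : V, vle x y -> vle (x + z) (y + z);
  vscale_ge0 : forall (a : R) (x : V), 0 <= a -> vle 0 x -> vle 0 (a *: x);
  vnorm_mono : forall x y : V,
    vle (vjoin x (- x)) (vjoin y (- y)) -> `|x| <= `|y|;
}.

#[short(type="banachLatticeType")]
HB.structure Definition BanachLattice (R : realType) :=
  {V of CompleteNormedModule R V & isBanachLattice R V}.

Notation "x <=v y" := (vle x y) : ring_scope.

(* A copy of [V] carrying its order as a [latticeType]. *)
Definition lattice_of (R : realType) (V : banachLatticeType R) : Type := V.

Section LatticeOf.
Context {R : realType} {V : banachLatticeType R}.

HB.instance Definition _ := Choice.on (lattice_of V).

HB.instance Definition _ := Order.Le_isPOrder.Build Order.default_display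
  (lattice_of V) (@vle_refl R V) (@vle_anti R V) (@vle_trans R V).

HB.instance Definition _ := Order.POrder_MeetJoin_isLattice.Build Order.default_display
  (lattice_of V) (@vle_meet R V) (@vle_join R V).

End LatticeOf.

Definition modulus (R : realType) (V : banachLatticeType R) (x : V) : V :=
  vjoin x (- x).

Definition dedekind_complete (R : realType) (V : banachLatticeType R) : Prop :=
  forall A : set (lattice_of V), has_sup A -> supremums A !=set0.

Definition disjoint_seq (R : realType) (V : banachLatticeType R)
    (x : nat -> V) : Prop :=
  forall n m : nat, n != m -> vmeet (modulus (x n)) (modulus (x m)) = 0.

Definition almost_order_bounded (R : realType) (V : banachLatticeType R)
    (A : set V) : Prop :=
  forall eps : R, 0 < eps ->
    exists2 u : V, 0 <=v u &
      A `<=` [set y + eps *: b | y in [set y | (- u <=v y) && (y <=v u)]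
                               & b in [set b | `|b| <= 1]].

(* The weak topology: the coarsest one making every norm-continuous linear
   functional continuous. *)
Definition weak (R : realType) (V : normedModType R) : topologicalType :=
  sup_topology (fun f : {f : {linear V -> R^o} | continuous f} =>
    Topological.on (initial_topology (sval f : V -> R^o))).

Definition relatively_weakly_compact (R : realType) (V : normedModType R)
    (A : set V) : Prop :=
  compact (closure (A : set (weak V))).

Definition positive_operator (R : realType) (E F : banachLatticeType R)
    (T : {linear E -> F}) : Prop :=
  forall x : E, 0 <=v x -> 0 <=v T x.

Definition almost_order_weakly_compact (R : realType)
    (E F : banachLatticeType R) (T : {linear E -> F}) : Prop :=
  continuous T /\
  forall A : set E, almost_order_bounded A ->
    relatively_weakly_compact (T @` A).

(* Main.v *)
From HB Require Import structures.
Require Import Defs.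
From mathcomp Require Import all_boot all_order all_algebra.
From mathcomp Require Import lra.
From mathcomp Require Import all_classical all_reals all_analysis.
Set Implicit Arguments.
Unset Strict Implicit.
Unset Printing Implicit Defensive.
Import Order.TTheory GRing.Theory Num.Theory.
Import numFieldNormedType.Exports.
Local Open Scope classical_set_scope.
Local Open Scope ring_scope.

(** Both properties of [T] are equivalent to a third one, [increments_null T]:
    [T (x n.+1 - x n)] tends to [0] in norm for every increasing order bounded
    sequence [x].

    Weak compactness gives null increments.  The images [T (x n)] increase
    inside a relatively weakly compact set, hence have a weak cluster point
    [y].  Separation puts [y] in the norm closure of the set of all [c] with
    [T (x N) <=v c <=v T (x n)] for some [n], whatever [N] is, and the
    monotonicity of the norm turns this into the Cauchy property
    ([weakly_compact_increasing]).  Applied to the partial sums of a disjoint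
    sequence, null increments give null images of order bounded disjoint
    sequences; an almost order bounded sequence is truncated at the cost of
    an arbitrarily small norm, which the bounded operator [T] preserves
    ([disjoint_seq_aob_null]).

    Conversely, null images of disjoint sequences give null increments.  The
    parts of the jumps [x n.+1 - x n] that cross a fixed level [t] form a
    disjoint sequence, and up to a small multiple of the order bound each jump
    is controlled by its crossings of finitely many levels
    ([level_grid], [disjoint_increments]).  It remains to pass from null
    increments to weak compactness, in three steps.

    - On an order interval, [`|T w|] is small as soon as [f w] is small, for a
      suitable single positive functional [f] ([absolutely_continuous]).
    - A convex filter is a filter with a base of convex sets.  If it is maximal
      among those, every nonnegative convex function that is bounded on some
      member has small oscillation on another one.  Sums of the functions
      [x |-> f (modulus (x - t))] over a fine grid of levels [t] play the role
      of the square of an L2 norm: small oscillation of such a sum on a convex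
      set forces [f (modulus (x - y))] to be small there
      ([convex_ultra_functional]).  Hence [T] maps maximal convex filters that
      live on order intervals, and then those that live on almost order bounded
      sets, to Cauchy filters
      ([convex_ultra_cauchy]).
    - Let [W] be an ultrafilter on the weak closure of [T @` A].  The convex
      sets that contain the preimage in [A] of a weakly open member of [W] lie
      in a maximal convex filter, whose image converges in norm to some [y],
      and half spaces being convex, [W] converges weakly to [y]
      ([aob_image_weakly_compact]). *)

(** * Vector lattices *)

Section VectorLattice.
Context {R : realType} {V : banachLatticeType R}.
Implicit Types (x y z u v w : V).

Definition vpos x : V := vjoin x 0.

Lemma vlexx x : x <=v x. Proof. exact: vle_refl. Qed.

Lemma vleT y x z : x <=v y -> y <=v z -> x <=v z.
Proof. exact: vle_trans. Qed.

Arguments vleT y {x z}.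

Lemma vle_eq x y : x <=v y -> y <=v x -> x = y.
Proof. by move=> xy yx; apply: vle_anti; rewrite xy yx. Qed.

Lemma vleD2rE z x y : (x + z <=v y + z) = (x <=v y).
Proof.
apply/idP/idP => [h|]; last exact: vleD2r.
by have := vleD2r (- z) _ _ h; rewrite !addrK.
Qed.

Lemma vleD2lE z x y : (z + x <=v z + y) = (x <=v y).
Proof. by rewrite ![z + _]addrC vleD2rE. Qed.

Lemma vsub_ge0 x y : (0 <=v y - x) = (x <=v y).
Proof. by rewrite -(vleD2rE x) add0r subrK. Qed.

Lemma vleBlDr x y z : (x - y <=v z) = (x <=v z + y).
Proof. by rewrite -(vleD2rE y) subrK. Qed.

Lemma vleBrDr x y z : (x <=v y - z) = (x + z <=v y).
Proof. by rewrite -(vleD2rE z) subrK. Qed.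

Lemma vleN2 x y : (- x <=v - y) = (y <=v x).
Proof. by rewrite -vsub_ge0 opprK addrC vsub_ge0. Qed.

Lemma vleNl x y : (- x <=v y) = (- y <=v x).
Proof. by rewrite -[y in LHS]opprK vleN2. Qed.

Lemma vleD x y z w : x <=v y -> z <=v w -> x + z <=v y + w.
Proof. by move=> xy zw; apply: (vleT (y + z)); rewrite ?vleD2rE ?vleD2lE. Qed.

Lemma vaddr_ge0 x y : 0 <=v x -> 0 <=v y -> 0 <=v x + y.
Proof. by move=> x0 y0; rewrite -[0]addr0 vleD. Qed.

Lemma vle_addr x y : 0 <=v y -> x <=v x + y.
Proof. by move=> y0; rewrite -{1}[x]addr0 vleD2lE. Qed.

Lemma vle_addl x y : 0 <=v y -> x <=v y + x.
Proof. by rewrite addrC; apply: vle_addr. Qed.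

Lemma vle_subl x y : 0 <=v y -> x - y <=v x.
Proof. by move=> y0; rewrite vleBlDr vle_addr. Qed.

Lemma vmuln_ge0 x n : 0 <=v x -> 0 <=v x *+ n.
Proof.
by move=> x0; elim: n => [|n ih]; rewrite ?mulr0n ?vlexx// mulrS vaddr_ge0.
Qed.

Lemma vle_incr (x : nat -> V) :
  (forall n, x n <=v x n.+1) -> forall n m, (n <= m)%N -> x n <=v x m.
Proof.
move=> xS n m /subnK <-; elim: (m - n)%N => [|k ih]; first exact: vlexx.
by apply: (vleT _ ih); exact: xS.
Qed.

Lemma vle_sum (I : Type) (r : seq I) (P : pred I) (f g : I -> V) :
  (forall i, P i -> f i <=v g i) ->
  \sum_(i <- r | P i) f i <=v \sum_(i <- r | P i) g i.
Proof.
move=> fg; apply: (big_ind2 (fun x y => x <=v y)) => //; first exact: vlexx.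
by move=> ? ? ? ?; apply: vleD.
Qed.

Lemma vsum_ge0 (I : Type) (r : seq I) (P : pred I) (f : I -> V) :
  (forall i, P i -> 0 <=v f i) -> 0 <=v \sum_(i <- r | P i) f i.
Proof.
move=> f0; apply: (big_ind (fun x => 0 <=v x)) => //; first exact: vlexx.
exact: vaddr_ge0.
Qed.

Lemma vle_scale (a : R) x y : 0 <= a -> x <=v y -> a *: x <=v a *: y.
Proof. by move=> a0 xy; rewrite -vsub_ge0 -scalerBr vscale_ge0 ?vsub_ge0. Qed.

Lemma vjoinl x y : x <=v vjoin x y.
Proof. by have := vle_join x y (vjoin x y); rewrite vlexx; case/esym/andP. Qed.

Lemma vjoinr x y : y <=v vjoin x y.
Proof. by have := vle_join x y (vjoin x y); rewrite vlexx; case/esym/andP. Qed.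

Lemma vmeetl x y : vmeet x y <=v x.
Proof. by have := vle_meet (vmeet x y) x y; rewrite vlexx; case/esym/andP. Qed.

Lemma vmeetr x y : vmeet x y <=v y.
Proof. by have := vle_meet (vmeet x y) x y; rewrite vlexx; case/esym/andP. Qed.

Lemma vjoin_le x y z : x <=v z -> y <=v z -> vjoin x y <=v z.
Proof. by rewrite vle_join => -> ->. Qed.

Lemma vmeet_ge x y z : z <=v x -> z <=v y -> z <=v vmeet x y.
Proof. by rewrite vle_meet => -> ->. Qed.

Lemma vmeetC x y : vmeet x y = vmeet y x.
Proof. by apply: vle_eq; apply: vmeet_ge; rewrite ?vmeetl ?vmeetr. Qed.

Lemma vjoinC x y : vjoin x y = vjoin y x.
Proof. by apply: vle_eq; apply: vjoin_le; rewrite ?vjoinl ?vjoinr. Qed.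

Lemma vjoinD2r x y z : vjoin (x + z) (y + z) = vjoin x y + z.
Proof.
apply: vle_eq.
  by apply: vjoin_le; rewrite vleD2rE ?vjoinl ?vjoinr.
by rewrite -vleBrDr; apply: vjoin_le; rewrite vleBrDr ?vjoinl ?vjoinr.
Qed.

Lemma vmeet_join x y : vmeet x y = x + y - vjoin x y.
Proof.
apply: vle_eq.
  rewrite vleBrDr addrC -vleBrDr; apply: vjoin_le; rewrite vleBrDr.
    by rewrite vleD2lE vmeetr.
  by rewrite addrC vleD2rE vmeetl.
by apply: vmeet_ge; rewrite vleBlDr ?vleD2lE ?vjoinr// addrC vleD2lE vjoinl.
Qed.

Lemma vpos_ge0 x : 0 <=v vpos x. Proof. exact: vjoinr. Qed.

Lemma vle_pos x : x <=v vpos x. Proof. exact: vjoinl. Qed.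

Lemma vpos_le x y : x <=v y -> 0 <=v y -> vpos x <=v y.
Proof. exact: vjoin_le. Qed.

Lemma vpos_mono x y : x <=v y -> vpos x <=v vpos y.
Proof.
by move=> xy; apply: vpos_le; rewrite ?vpos_ge0// (vleT y)// vle_pos.
Qed.

Lemma vpos_id x : 0 <=v x -> vpos x = x.
Proof.
by move=> x0; apply: vle_eq; [exact: vpos_le (vlexx _) _|exact: vle_pos].
Qed.

Lemma vpos_sub x y : vpos (y - x) = vjoin x y - x.
Proof. by rewrite /vpos -(subrr x) vjoinD2r vjoinC. Qed.

Lemma vposN x : vpos (- x) = vpos x - x.
Proof. by rewrite -{1}[- x]sub0r vpos_sub. Qed.

Lemma vposB x : vpos x - vpos (- x) = x.
Proof. by rewrite vposN subKr. Qed.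

Lemma vpos_meetN x : vmeet (vpos x) (vpos (- x)) = 0.
Proof.
apply: vle_eq; last by apply: vmeet_ge; exact: vpos_ge0.
set w := vmeet _ _.
rewrite -(vleD2lE (vpos x)) addr0 -vleBrDr; apply: vjoin_le; rewrite vleBrDr.
  by rewrite addrC -vleBrDr (vleT (vpos (- x))) ?vmeetr// vposN vlexx.
by rewrite add0r vmeetl.
Qed.

Lemma vmeet0_le x y x' y' : 0 <=v x' -> 0 <=v y' -> x' <=v x -> y' <=v y ->
  vmeet x y = 0 -> vmeet x' y' = 0.
Proof.
move=> x0 y0 xx yy xy; apply: vle_eq; last exact: vmeet_ge.
rewrite -xy; apply: vmeet_ge.
  by apply: (vleT x') => //; exact: vmeetl.
by apply: (vleT y') => //; exact: vmeetr.
Qed.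

(** An element below [x + y] and [z] is below [y] once [x] is disjoint from [z],
    because its excess over [y] is below both [x] and [z]. *)
Lemma vmeetD_eq0 x y z : 0 <=v x -> 0 <=v y -> 0 <=v z ->
  vmeet x z = 0 -> vmeet y z = 0 -> vmeet (x + y) z = 0.
Proof.
move=> x0 y0 z0 xz yz; apply: vle_eq; last by rewrite vmeet_ge ?vaddr_ge0.
set w := vmeet _ _.
rewrite -yz; apply: vmeet_ge; last exact: vmeetr.
rewrite -[y]add0r -vleBlDr -xz; apply: vmeet_ge.
  by rewrite vleBlDr vmeetl.
by rewrite vleBlDr (vleT z) ?vmeetr// vle_addr.
Qed.

Lemma vjoin_add x y : vmeet x y = 0 -> vjoin x y = x + y.
Proof. by rewrite vmeet_join => /eqP; rewrite subr_eq0 => /eqP. Qed.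

(** ** The modulus *)

Lemma midpointxx x : 2^-1 *: (x + x) = x.
Proof. by rewrite scalerDr -scalerDl -div1r -splitr scale1r. Qed.

Lemma vle_mod x : x <=v modulus x. Proof. exact: vjoinl. Qed.

Lemma vleN_mod x : - x <=v modulus x. Proof. exact: vjoinr. Qed.

Lemma mod_le x y : x <=v y -> - x <=v y -> modulus x <=v y.
Proof. exact: vjoin_le. Qed.

Lemma modN x : modulus (- x) = modulus x.
Proof. by rewrite /modulus opprK vjoinC. Qed.

Lemma modE x : modulus x = vpos x + vpos (- x).
Proof.
rewrite -vjoin_add ?vpos_meetN//; apply: vle_eq.
  apply: mod_le; first by rewrite (vleT (vpos x)) ?vle_pos ?vjoinl.
  by rewrite (vleT (vpos (- x))) ?vle_pos ?vjoinr.
have h : 0 <=v modulus x.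
  have : 0 <=v (2^-1 : R) *: (modulus x + modulus x).
    by rewrite vscale_ge0// -(subrr x) vleD ?vle_mod ?vleN_mod.
  by rewrite midpointxx.
by apply: vjoin_le; apply: vpos_le; rewrite ?vle_mod ?vleN_mod.
Qed.

Lemma mod_ge0 x : 0 <=v modulus x.
Proof. by rewrite modE vaddr_ge0// vpos_ge0. Qed.

Lemma mod_id x : 0 <=v x -> modulus x = x.
Proof.
move=> x0; apply: vle_eq (vle_mod _); apply: mod_le (vlexx _) _.
by rewrite (vleT 0)// -oppr0 vleN2.
Qed.

Lemma mod_itv x u : (modulus x <=v u) = (- u <=v x) && (x <=v u).
Proof. by rewrite /modulus vle_join andbC vleNl. Qed.

Lemma mod_D x y : modulus (x + y) <=v modulus x + modulus y.
Proof.
by apply: mod_le; rewrite ?opprD vleD ?vle_mod ?vleN_mod.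
Qed.

Lemma mod_B x y : modulus (x - y) <=v modulus x + modulus y.
Proof. by rewrite -[modulus y]modN mod_D. Qed.

Lemma mod_scale (a : R) x : 0 <= a -> modulus (a *: x) = a *: modulus x.
Proof.
rewrite le_eqVlt => /predU1P[<-|a0].
  by rewrite !scale0r mod_id ?vlexx.
have le b z : 0 < b -> modulus (b *: z) <=v b *: modulus z.
  move=> b0; apply: mod_le; rewrite -?scalerN vle_scale ?(ltW b0) ?vle_mod//.
  exact: vleN_mod.
apply: vle_eq (le _ _ a0) _.
have := vle_scale (ltW a0) (le a^-1 (a *: x) _).
by rewrite invr_gt0 !scalerA mulfV ?mulVf ?gt_eqF// !scale1r; apply.
Qed.

Lemma mod_midpoint x y u : modulus x <=v u -> modulus y <=v u ->
  modulus (2^-1 *: (x + y)) <=v u.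
Proof.
move=> xu yu; rewrite mod_scale ?invr_ge0// -[u]midpointxx.
by rewrite vle_scale ?invr_ge0// (vleT (modulus x + modulus y)) ?mod_D ?vleD.
Qed.

Lemma mod_mul2 x : modulus (x *+ 2) = modulus x *+ 2.
Proof.
have e y : y *+ 2 = (2 : R) *: y by rewrite scaler_nat.
by rewrite !e mod_scale.
Qed.

(** ** The norm *)

Lemma norm_mod x : `|modulus x| = `|x|.
Proof.
have e : modulus (modulus x) = modulus x by rewrite mod_id ?mod_ge0.
by apply/eqP; rewrite eq_le !vnorm_mono// -!/(modulus _) e vlexx.
Qed.

Lemma norm_le x y : modulus x <=v y -> `|x| <= `|y|.
Proof.
move=> xy; apply: vnorm_mono; rewrite -!/(modulus _).
by apply: vleT xy _; exact: vle_mod.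
Qed.

Lemma norm_mono x y : 0 <=v x -> x <=v y -> `|x| <= `|y|.
Proof. by move=> x0 xy; apply: norm_le; rewrite mod_id. Qed.

(** The positive cone is closed: the negative part of [x] is dominated by the
    distance from [x] to any positive element. *)
Lemma vpos_closed x :
  (forall e : R, 0 < e -> exists2 y, 0 <=v y & `|y - x| <= e) -> 0 <=v x.
Proof.
move=> h; suff : vpos (- x) = 0.
  by move=> e; rewrite -[x]vposB e subr0 vpos_ge0.
apply/eqP; rewrite -normr_le0; apply/ler_addgt0Pl => e /h[y y0 yx].
rewrite addr0 (le_trans _ yx)// -(norm_mod (y - x)) norm_mono ?vpos_ge0//.
rewrite vpos_le ?mod_ge0// (vleT (y - x)) ?vle_mod//.
exact: vle_addl.
Qed.

End VectorLattice.

Arguments vleT {R V} y {x z}.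

(** * Grids of levels *)

Section Grid.
Context {R : realType} {V : banachLatticeType R}.
Implicit Types x y v s D a b t : V.

(** The levels [v *+ j] for [j <= N] form a grid of mesh [v] that covers [s].
    For real numbers one of them is within [v] of [s], so that one summand alone
    makes up for [D - v].  In a vector lattice the nearest level cannot be
    selected; the induction on the number of levels replaces this selection. *)
Lemma level_grid v s D N : 0 <=v v -> 0 <=v s -> s <=v v *+ N ->
  D <=v v + \sum_(j < N.+1) vpos (D - modulus (s - v *+ j)).
Proof.
move=> v0 s0 sN.
suff gen k : D <=v v + vpos (s - v *+ k)
    + \sum_(j < k.+1) vpos (D - modulus (s - v *+ j)).
  have e : vpos (s - v *+ N) = 0.
    apply: vle_eq (vpos_ge0 _); apply: vpos_le (vlexx _).
    by rewrite vleBlDr add0r.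
  by have := gen N; rewrite e addr0.
elim: k => [|k ih].
  rewrite big_ord1 mulr0n subr0 mod_id// vpos_id//.
  rewrite -addrA (vleT (s + vpos (D - s))) ?vle_addl//.
  by rewrite addrC -vleBlDr vle_pos.
rewrite big_ord_recr /= addrA.
set S := \sum_(j < k.+1) _ in ih *.
have S0 : 0 <=v S by apply: vsum_ge0 => i _; exact: vpos_ge0.
rewrite mulrSr opprD addrA.
set p := s - v *+ k in ih *; set P := vpos (D - modulus (p - v)).
set q := vpos (p - v).
have P0 : 0 <=v P by exact: vpos_ge0.
have q0 : 0 <=v q by exact: vpos_ge0.
(* The excess of [D] over the claimed bound lies below both the positive and
   the negative part of [p], hence below [0]. *)
have h1 : D - v - S - P - q <=v vpos p.
  rewrite (vleT (D - v - S - P)) ?vle_subl// (vleT (D - v - S)) ?vle_subl//.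
  by rewrite !vleBlDr addrC addrA.
have h2 : D - v - S - P - q <=v vpos (- p).
  rewrite (vleT (D - v - P - q)) ?vleD2rE ?vle_subl// !vleBlDr.
  rewrite (vleT (q + vpos (v - p) + P))//.
    by rewrite -[v - p]opprB -modE addrC -vleBlDr vle_pos.
  rewrite [vpos _ + q]addrC [_ + v]addrAC vleD2rE -addrA vleD2lE.
  apply: vpos_le; last by rewrite vaddr_ge0 ?vpos_ge0.
  by rewrite [v - p]addrC vleD2rE vle_pos.
have := vmeet_ge h1 h2; rewrite vpos_meetN !vleBlDr add0r.
by rewrite [q + P + S]addrAC [_ + v]addrC !addrA.
Qed.

(** The left side is twice the positive part of half of [b - a] minus the
    distance from the level to the midpoint of [a] and [b], where the level is
    half of [t].  The right side is twice the amount by which [b] is above and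
    [a] is below that level: large jumps are bounded by their crossings. *)
Lemma crossing a b t :
  vpos (b - a - modulus (a + b - t)) <=v
  vmeet (vpos (b *+ 2 - t)) (vpos (t - a *+ 2)).
Proof.
set r := a + b - t.
have e1 : b *+ 2 - t = b - a + r.
  by rewrite /r mulr2n !addrA subrK.
have e2 : t - a *+ 2 = b - a - r.
  rewrite /r opprB addrCA [- (a + b)]opprD [- a - b]addrC addrACA subrr.
  by rewrite add0r -opprD mulr2n.
apply: vmeet_ge; apply: vpos_mono; rewrite vleBlDr ?e1 ?e2 -addrA vle_addr//.
  by rewrite -(subrr r) vleD2lE vleN_mod.
by rewrite addrC vsub_ge0 vle_mod.
Qed.

(** The right side is the defect of midpoint convexity of
    [x |-> modulus (x - t)].  It is large where the level [t] is close to the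
    midpoint of [x] and [y] compared with their distance. *)
Lemma midpoint_gap x y t :
  vpos (modulus (x - y) - modulus (x + y - t *+ 2)) <=v
  modulus (x - t) + modulus (y - t) - modulus (x + y - t *+ 2).
Proof.
have e : x + y - t *+ 2 = (x - t) + (y - t) by rewrite mulr2n opprD addrACA.
have e' : x - y = (x - t) - (y - t) by rewrite opprB addrA subrK.
apply: vpos_le; first by rewrite vleD2rE e' mod_B.
by rewrite vsub_ge0 e mod_D.
Qed.

End Grid.

(** * Positive operators are bounded *)

Section PositiveOperator.
Context {R : realType} {E F : banachLatticeType R}.
Variables (T : {linear E -> F}) (T0 : positive_operator T).
Implicit Types x y u : E.

Lemma pos_le x y : x <=v y -> T x <=v T y.
Proof. by move=> xy; rewrite -vsub_ge0 -raddfB T0// vsub_ge0. Qed.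

Lemma pos_mod x : modulus (T x) <=v T (modulus x).
Proof.
apply: mod_le; first exact: pos_le (vle_mod _).
by rewrite -raddfN; exact: pos_le (vleN_mod _).
Qed.

Lemma norm_pos_mod x y : modulus x <=v y -> `|T x| <= `|T y|.
Proof.
move=> xy; apply: norm_le; apply: (vleT _ (pos_mod x)); exact: pos_le.
Qed.

Lemma norm_pos x y : 0 <=v x -> x <=v y -> `|T x| <= `|T y|.
Proof. by move=> x0 xy; apply: norm_pos_mod; rewrite mod_id. Qed.

(** Otherwise a convergent series of positive terms [x n] with sum [s] would
    satisfy [n%:R <= `|T (x n)|] for all [n], whereas [x n <=v s]. *)
Lemma pos_bounded : exists2 M : R, 0 < M & forall x, `|T x| <= M * `|x|.
Proof.
apply: contrapT => nb.
have nb' (n : nat) : exists x : E,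
    [/\ 0 <=v x, `|x| <= 2^-1 ^+ n & n%:R <= `|T x|].
  apply: contrapT => h; apply: nb; exists (n.+1%:R * 2 ^+ n) => [|x].
    by rewrite mulr_gt0// exprn_gt0.
  have [->|x0] := eqVneq x 0; first by rewrite raddf0 !normr0 mulr0.
  rewrite leNgt; apply/negP => hx; apply: h.
  have c0 : 0 < 2 ^+ n * `|x| by rewrite mulr_gt0 ?exprn_gt0 ?normr_gt0.
  have c0V : 0 < (2 ^+ n * `|x|)^-1 by rewrite invr_gt0.
  exists ((2 ^+ n * `|x|)^-1 *: modulus x); split.
  - by rewrite vscale_ge0 ?mod_ge0// ltW.
  - rewrite normrZ norm_mod gtr0_norm// invfM -mulrA mulVf ?normr_eq0// mulr1.
    by rewrite exprVn.
  - rewrite linearZ normrZ gtr0_norm// mulrC ler_pdivlMr//.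
    rewrite (le_trans _ (norm_pos_mod (vlexx _)))// mulrA.
    rewrite (le_trans _ (ltW hx))//.
    by rewrite ler_wpM2r// ler_wpM2r ?exprn_ge0// ler_nat.
have [x hx] := choice nb'.
have cx : cvgn (series x).
  apply: normed_cvg; apply: (series_le_cvg (v_ := geometric 1 2^-1)).
  - by move=> n; exact: normr_ge0.
  - by move=> n; rewrite /= mul1r exprn_ge0.
  - by move=> n; rewrite /= mul1r; case: (hx n).
  - by apply: is_cvg_geometric_series; rewrite gtr0_norm ?invf_lt1 ?ltr1n.
pose s := limn (series x).
have xs n : x n <=v s.
  rewrite -vsub_ge0; apply: vpos_closed => e e0.
  have [N _ hN] := (cvgrPdist_le _ _).1 cx e e0.
  exists (series x (N + n.+1)%N - x n).
    rewrite seriesEnat /= big_mkord (bigD1 (Ordinal (leq_addl N (n.+1))))//=.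
    rewrite addrAC subrr add0r.
    by apply: vsum_ge0 => i _; case: (hx i).
  rewrite opprB addrA subrK distrC.
  by apply: hN; rewrite /= leq_addr.
have [n hn] : exists n : nat, `|T s| < n%:R.
  by exists (Num.truncn `|T s|).+1; exact: truncnS_gt.
have [x0 _ xn] := hx n.
by have := lt_le_trans hn (le_trans xn (norm_pos x0 (xs n))); rewrite ltxx.
Qed.

End PositiveOperator.

(** * Separation by linear functionals *)

Section MazurOrlicz.
Context {R : realType} {V : lmodType R}.
Implicit Types (p q : V -> R) (C : set V) (x y : V).

(** Homogeneity as an inequality is enough: equality for positive scalars
    follows by scaling back. *)
Definition sublinear p :=
  (forall x y, p (x + y) <= p x + p y) /\
  (forall (a : R) x, 0 <= a -> p (a *: x) <= a * p x).

Definition vconvex C := forall x y (a b : R), 0 <= a -> 0 <= b -> a + b = 1 ->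
  C x -> C y -> C (a *: x + b *: y).

Lemma sublinear0 p : sublinear p -> p 0 = 0.
Proof.
move=> [pD pZ]; apply/le_anti; have := pZ 0 0 (lexx _).
rewrite scale0r mul0r => -> /=.
by have := pD 0 0; rewrite addr0 -lerBlDr subrr.
Qed.

Lemma sublinear_lb p x : sublinear p -> - p (- x) <= p x.
Proof.
move=> sp; rewrite -subr_ge0 opprK -[X in X <= _](sublinear0 sp) -(subrr x).
exact: sp.1.
Qed.

(** The functional [q] is the infimum of [p (x + t *: c) - t * eps] over
    [0 <= t] and [c] in [C]. *)
Lemma sublinear_push p C eps : sublinear p -> vconvex C -> C !=set0 ->
  (forall c, C c -> eps <= p c) ->
  exists q, [/\ sublinear q, forall x, q x <= p x &
                forall c, C c -> q (- c) <= - eps].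
Proof.
move=> sp cC [c0 Cc0] pC; have [pD pZ] := sp.
pose A x := [set r | exists t c,
  [/\ 0 <= t, C c & r = p (x + t *: c) - t * eps]].
have lbA x : lbound (A x) (- p (- x)).
  move=> _ [t [c [t0 Cc ->]]].
  rewrite lerBrDr addrC lerBlDl.
  have h : t * eps <= p (t *: c).
    move: t0; rewrite le_eqVlt => /predU1P[<-|t0].
      by rewrite mul0r scale0r sublinear0.
    rewrite -ler_pdivlMl//; apply: (le_trans (pC _ Cc)).
    have := pZ t^-1 (t *: c); rewrite scalerA mulVf ?gt_eqF// scale1r.
    by apply; rewrite invr_ge0 ltW.
  rewrite (le_trans h)//; have := pD (- x) (x + t *: c).
  by rewrite addKr.
have hA x : has_inf (A x).
  split; last by exists (- p (- x)); exact: lbA.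
  by exists (p (x + 0 *: c0) - 0 * eps), 0, c0.
have ub x t c : 0 <= t -> C c -> inf (A x) <= p (x + t *: c) - t * eps.
  by move=> t0 Cc; apply: ge_inf; [exact: (hA x).2|exists t, c].
exists (fun x => inf (A x)); split; [split|..].
- move=> x y; rewrite -lerBlDr; apply: lb_le_inf (hA x).1 _.
  move=> _ [t [c [t0 Cc ->]]]; rewrite lerBlDr -lerBlDl.
  apply: lb_le_inf (hA y).1 _ => _ [s [d [s0 Cd ->]]].
  rewrite lerBlDl.
  have [ts0|ts0] := eqVneq (t + s) 0.
    have /andP[/eqP -> /eqP ->] : (t == 0) && (s == 0).
      by rewrite -paddr_eq0 ?ts0.
    rewrite !scale0r !mul0r !addr0 !subr0 (le_trans _ (pD x y))//.
    by have := ub (x + y) 0 c (lexx _) Cc; rewrite scale0r mul0r addr0 subr0.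
  have ts : 0 < t + s by rewrite lt_neqAle eq_sym ts0 addr_ge0.
  have Ce : C ((t / (t + s)) *: c + (s / (t + s)) *: d).
    by apply: cC => //; rewrite ?divr_ge0 ?(ltW ts)// -mulrDl mulfV.
  apply: le_trans (ub _ _ _ (ltW ts) Ce) _.
  rewrite scalerDr !scalerA mulrCA mulfV// mulr1 mulrCA mulfV// mulr1.
  by rewrite mulrDl opprD [leRHS]addrACA lerD2r addrACA pD.
- move=> a x; rewrite le_eqVlt => /predU1P[<-|a0].
    rewrite mul0r scale0r.
    have := ub 0 0 c0 (lexx _) Cc0.
    by rewrite scale0r mul0r addr0 subr0 sublinear0.
  rewrite -ler_pdivrMl//; apply: lb_le_inf (hA x).1 _ => _ [t [c [t0 Cc ->]]].
  rewrite ler_pdivrMl// mulrBr mulrA; apply: le_trans (ub _ (a * t) c _ Cc) _.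
    by rewrite mulr_ge0// ltW.
  by rewrite lerD2r -scalerA -scalerDr pZ// ltW.
- move=> x; have := ub x 0 c0 (lexx _) Cc0.
  by rewrite scale0r mul0r addr0 subr0.
- move=> c Cc; have := ub (- c) 1 c ler01 Cc.
  by rewrite scale1r addNr mul1r sublinear0// sub0r.
Qed.

(** Zorn's lemma: the infimum of a chain of sublinear functionals below [p] is
    sublinear, and finite by [sublinear_lb]. *)
Lemma minimal_sublinear p : sublinear p -> exists q, [/\ sublinear q,
  forall x, q x <= p x &
  forall q', sublinear q' -> (forall x, q' x <= q x) -> q' = q].
Proof.
move=> sp; pose T := {q : V -> R | sublinear q /\ forall x, q x <= p x}.
pose le (s t : T) : bool := `[< forall x, sval t x <= sval s x >].
have tinj (s t : T) : sval s = sval t -> s = t.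
  by case: s t => [s hs] [t ht] /= st; exact: eq_exist.
have [||||[q [sq qp]] qmin] := @Zorn T le.
- by move=> t; apply/asboolP.
- move=> r s t /asboolP rs /asboolP st; apply/asboolP => x.
  exact: le_trans (st x) (rs x).
- move=> s t /asboolP st /asboolP ts; apply/tinj/funext => x.
  by apply/le_anti; rewrite st ts.
- move=> A Atot; have [A0|/set0P[s0 As0]] := eqVneq A set0.
    by exists (exist _ p (conj sp (fun=> lexx _))) => s; rewrite A0.
  pose B x := [set sval s x | s in A].
  have hB x : has_inf (B x).
    split; first by exists (sval s0 x), s0.
    exists (- p (- x)) => _ [s As <-].
    apply: le_trans (sublinear_lb x (proj2_sig s).1).
    by rewrite lerN2 (proj2_sig s).2.
  have ub x s : A s -> inf (B x) <= sval s x.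
    by move=> As; apply: ge_inf; [exact: (hB x).2|exists s].
  have sq : sublinear (fun x => inf (B x)).
    split.
      move=> x y; rewrite -lerBlDr; apply: lb_le_inf (hB x).1 _ => _ [s As <-].
      rewrite lerBlDr -lerBlDl; apply: lb_le_inf (hB y).1 _ => _ [t At <-].
      rewrite lerBlDl; case: (Atot s t As At) => /asboolP h.
        apply: le_trans (ub _ t At) (le_trans ((proj2_sig t).1.1 x y) _).
        by rewrite lerD2r h.
      apply: le_trans (ub _ s As) (le_trans ((proj2_sig s).1.1 x y) _).
      by rewrite lerD2l h.
    move=> a x; rewrite le_eqVlt => /predU1P[<-|a0].
      rewrite mul0r; apply: le_trans (ub _ s0 As0) _.
      by rewrite -[leRHS](mul0r (sval s0 x)); exact: (proj2_sig s0).1.2.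
    rewrite -ler_pdivrMl//; apply: lb_le_inf (hB x).1 _ => _ [s As <-].
    rewrite ler_pdivrMl//; apply: le_trans (ub _ s As) _.
    by apply: (proj2_sig s).1.2; exact: ltW.
  have qp x : inf (B x) <= p x.
    exact: le_trans (ub _ s0 As0) ((proj2_sig s0).2 x).
  exists (exist _ (fun x => inf (B x)) (conj sq qp)) => s As.
  by apply/asboolP => x /=; exact: ub.
exists q; split=> // q' sq' q'q.
have q'p x : q' x <= p x by exact: le_trans (q'q x) (qp x).
have := qmin (exist _ q' (conj sq' q'p)).
by case/(_ _)/wrap => [|[]//]; apply/asboolP.
Qed.

(** A minimal sublinear functional [q] is linear: lowering it along a single
    direction [x] by [sublinear_push] cannot change it, which says
    [q (- x) = - q x]. *)
Theorem mazur_orlicz p C eps : sublinear p -> vconvex C -> C !=set0 ->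
  (forall c, C c -> eps <= p c) ->
  exists f : {linear V -> R^o},
    (forall x, f x <= p x) /\ (forall c, C c -> eps <= f c).
Proof.
move=> sp cC C0 pC.
have [q1 [sq1 q1p q1C]] := sublinear_push sp cC C0 pC.
have [q [sq qq1 qmin]] := minimal_sublinear sq1.
have qN x : q (- x) = - q x.
  have c1 : vconvex [set x].
    by move=> _ _ a b _ _ ab -> ->; rewrite -scalerDl ab scale1r.
  have [|c -> //|q2 [sq2 q2q q2x]] := @sublinear_push q [set x] (q x) sq c1.
    by exists x.
  apply/le_anti/andP; split.
    by rewrite -(qmin _ sq2 q2q) in q2x *; exact: q2x.
  by have := sublinear_lb (- x) sq; rewrite opprK.
have qD x y : q (x + y) = q x + q y.
  apply/le_anti; rewrite sq.1/= -lerBrDr -qN.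
  by rewrite (le_trans _ (sq.1 _ _))// addrK.
have qZ0 (a : R) x : 0 <= a -> q (a *: x) = a * q x.
  move=> a0; apply/le_anti; rewrite sq.2//=.
  by rewrite -[leRHS]opprK -qN -scalerN lerNr -mulrN -qN sq.2.
have qlin : linear (q : V -> R^o).
  move=> a x y; rewrite qD; congr (_ + _).
  have [a0|a0] := leP 0 a; first exact: qZ0.
  by rewrite -[LHS]opprK -qN -scaleNr qZ0 ?oppr_ge0 ?ltW// mulNr opprK.
pose f : {linear V -> R^o} := HB.pack (q : V -> R^o)
  (@GRing.isLinear.Build _ _ _ _ (q : V -> R^o) qlin).
exists f; split=> [x|c Cc] /=; first exact: le_trans (qq1 x) (q1p x).
by rewrite -[leRHS]opprK -qN lerNr (le_trans (qq1 _))// q1C.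
Qed.

End MazurOrlicz.

(** * Images of monotone sequences *)

Section Increments.
Context {R : realType} {E F : banachLatticeType R}.
Variables (T : {linear E -> F}) (T0 : positive_operator T).
Implicit Types (x y u : E).

Definition disjoint_null := forall (y : nat -> E) u,
  (forall n, 0 <=v y n) -> (forall n, y n <=v u) ->
  (forall n m, (n < m)%N -> vmeet (y n) (y m) = 0) ->
  (fun n => `|T (y n)|) @ \oo --> (0 : R).

Definition increments_null := forall (x : nat -> E) u,
  (forall n, 0 <=v x n) -> (forall n, x n <=v u) ->
  (forall n, x n <=v x n.+1) ->
  (fun n => `|T (x n.+1 - x n)|) @ \oo --> (0 : R).

(** The crossings of a fixed level by the successive jumps of an increasing
    sequence are pairwise disjoint: after the jump number [n] the sequence is
    above the level wherever that jump crossed it. *)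
Lemma disjoint_increments : disjoint_null -> increments_null.
Proof.
move=> dn x u x0 xu xS.
have u0 : 0 <=v u by exact: vleT (x0 0%N) (xu 0%N).
have mono := vle_incr xS.
apply/cvgrPdist_le => e e0.
have [N hN] : exists N : nat, `|T (u *+ 2)| <= N.+1%:R * (e / 2).
  exists (Num.truncn (`|T (u *+ 2)| / (e / 2))).
  by rewrite -ler_pdivrMr ?divr_gt0// ltW// truncnS_gt.
pose v := N.+1%:R^-1 *: (u *+ 2).
have vN : v *+ N.+1 = u *+ 2.
  by rewrite /v -[LHS]scaler_nat scalerA mulfV ?scale1r// pnatr_eq0.
have v0 : 0 <=v v by rewrite vscale_ge0 ?invr_ge0 ?ler0n// vmuln_ge0.
have Tv : `|T v| <= e / 2.
  rewrite /v linearZ normrZ gtr0_norm ?invr_gt0 ?ltr0n//.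
  by rewrite ler_pdivrMl ?ltr0n.
(* [y j n] is twice the part of the jump number [n] across half of [v *+ j]. *)
pose y (j n : nat) :=
  vmeet (vpos (x n.+1 *+ 2 - v *+ j)) (vpos (v *+ j - x n *+ 2)).
have y0 j n : 0 <=v y j n by apply: vmeet_ge; exact: vpos_ge0.
have cy j : (fun n => `|T (y j n)|) @ \oo --> (0 : R).
  apply: (dn (y j) (v *+ j)) => // [n|n m nm].
    apply: vleT _ (vmeetr _ _) _; apply: vpos_le; last exact: vmuln_ge0.
    by rewrite vle_subl// vmuln_ge0.
  apply: (vmeet0_le _ _ _ _ (vpos_meetN (x n.+1 *+ 2 - v *+ j))) => //.
    exact: vmeetl.
  apply: vleT _ (vmeetr _ _) _; apply: vpos_mono.
  by rewrite opprB vleD2lE vleN2 !mulr2n vleD ?mono.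
have step n : `|T (x n.+1 - x n)| <= e / 2 + \sum_(j < N.+2) `|T (y j n)|.
  have le_step : x n.+1 - x n <=v v + \sum_(j < N.+2) y j n.
    apply: (vleT (v + \sum_(j < N.+2)
        vpos (x n.+1 - x n - modulus (x n + x n.+1 - v *+ j)))).
      apply: level_grid => //; first exact: vaddr_ge0.
      by rewrite vN mulr2n vleD.
    by rewrite vleD2lE; apply: vle_sum => j _; exact: crossing.
  have d0 : 0 <=v x n.+1 - x n by rewrite vsub_ge0.
  rewrite (le_trans (norm_pos T0 d0 le_step))// raddfD.
  rewrite (le_trans (ler_normD _ _))// lerD//.
  by rewrite raddf_sum ler_norm_sum.
have cs k : (fun n => \sum_(j < k) `|T (y j n)|) @ \oo --> (0 : R).
  elim: k => [|k ih].
    by under eq_fun do rewrite big_ord0; exact: cvg_cst.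
  have -> : (fun n => \sum_(j < k.+1) `|T (y j n)|) =
      (fun n => \sum_(j < k) `|T (y j n)| + `|T (y k n)|).
    by apply/funext => n; rewrite big_ord_recr.
  by have c := cvgD ih (cy k); rewrite addr0 in c; exact: c.
have e2 : 0 < e / 2 by rewrite divr_gt0.
have [M _ hM] := (cvgrPdist_le _ _).1 (cs N.+2) (e / 2) e2.
exists M => // n /hM; rewrite !sub0r !normrN => h.
rewrite normr_id (le_trans (step n))// [leRHS]splitr lerD2l.
by rewrite (le_trans (ler_norm _)).
Qed.

Hypothesis incr : increments_null.

Lemma no_big_increments (x : nat -> E) u (e : R) : 0 < e ->
  (forall n, 0 <=v x n) -> (forall n, x n <=v u) ->
  (forall n, x n <=v x n.+1) -> exists n, `|T (x n.+1 - x n)| <= e.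
Proof.
move=> e0 x0 xu xS.
have [M _ hM] := (cvgrPdist_le _ _).1 (incr x0 xu xS) e e0.
by exists M; have := hM M (leqnn M); rewrite sub0r normrN normr_id.
Qed.

(** If no element of [S] were almost maximal, joining would produce an
    increasing sequence in [S] all of whose increments have large images. *)
Lemma join_closed_almost_max (S : set E) u (e : R) : 0 < e -> S !=set0 ->
  (forall x, S x -> 0 <=v x /\ x <=v u) ->
  (forall x y, S x -> S y -> S (vjoin x y)) ->
  exists2 x, S x & forall y, S y -> `|T (vjoin x y - x)| <= e.
Proof.
move=> e0 [x0 Sx0] Su SJ; apply: contrapT => h.
have /choice[g hg] : forall x, exists y, S x -> S y /\ e < `|T (vjoin x y - x)|.
  move=> x; apply: contrapT => hx; apply: h.
  have Sx : S x by apply: contrapT => nSx; apply: hx; exists x.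
  exists x => // y Sy; rewrite leNgt; apply/negP => xy.
  by apply: hx; exists y.
pose x n := iter n (fun x => vjoin x (g x)) x0.
have Sx n : S (x n) by elim: n => //= n ih; apply: SJ ih (hg _ ih).1.
have [|||n] := @no_big_increments x u e e0.
- by move=> n; exact: (Su _ (Sx n)).1.
- by move=> n; exact: (Su _ (Sx n)).2.
- by move=> n; exact: vjoinl.
by rewrite leNgt (hg _ (Sx n)).2.
Qed.

End Increments.

(** * Domination by a positive functional on order intervals *)

Section AbsoluteContinuity.
Context {R : realType} {E F : banachLatticeType R}.
Variables (T : {linear E -> F}) (T0 : positive_operator T).
Implicit Types (x y u w : E) (f : {linear E -> R^o}).

Definition posfun f := forall x, 0 <=v x -> 0 <= f x.

Lemma posfun_le f x y : posfun f -> x <=v y -> f x <= f y.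
Proof. by move=> f0; rewrite -vsub_ge0 => /f0; rewrite raddfB subr_ge0. Qed.

(** The Mazur-Orlicz theorem for [x |-> `|T (vpos x)|], which vanishes on
    negative elements, so that the functionals below it are positive. *)
Lemma norming_functional w : 0 <=v w -> exists f,
  [/\ posfun f, forall x, 0 <=v x -> f x <= `|T x| & `|T w| <= f w].
Proof.
move=> w0; pose p x := `|T (vpos x)|.
have sp : sublinear p.
  split=> [x y|a x a0].
    rewrite (le_trans _ (ler_normD _ _))// -raddfD norm_pos ?vpos_ge0//.
    by rewrite vpos_le ?vaddr_ge0 ?vpos_ge0// vleD ?vle_pos.
  rewrite -[a in leRHS]ger0_norm// -normrZ -linearZ norm_pos ?vpos_ge0//.
  by rewrite vpos_le ?vle_scale ?vscale_ge0 ?vle_pos ?vpos_ge0.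
have c1 : vconvex [set w].
  by move=> _ _ a b _ _ ab -> ->; rewrite -scalerDl ab scale1r.
have [||f [fp fw]] := mazur_orlicz (eps := p w) sp c1.
- by exists w.
- by move=> _ ->.
exists f; split.
- move=> x x0; rewrite -oppr_le0 -raddfN (le_trans (fp _))//.
  rewrite /p; have -> : vpos (- x) = 0; last by rewrite raddf0 normr0.
  apply: vle_eq (vpos_ge0 _); apply: vpos_le (vlexx _).
  by rewrite -oppr0 vleN2.
- by move=> x x0; rewrite (le_trans (fp _))// /p vpos_id.
- by have := fw w erefl; rewrite /p vpos_id.
Qed.

Hypothesis incr : increments_null T.

Let h (i : nat) : R := 2^-1 ^+ i.+1.

Let h_gt0 i : 0 < h i. Proof. by rewrite exprn_gt0// invr_gt0. Qed.

Let sum_h_lt1 n : \sum_(i < n) h i <= 1.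
Proof.
suff -> : \sum_(i < n) h i = 1 - 2^-1 ^+ n by rewrite gerBl exprn_ge0.
elim: n => [|n ih]; first by rewrite big_ord0 expr0 subrr.
rewrite big_ord_recr/= ih /h exprS; set a := _ ^+ n.
lra.
Qed.

(** If no functional works, choose recursively [w n] in the order interval and
    norming functionals [g n], with [`|T (w n)|] bounded below but [g i (w n)]
    tiny for [i < n]; the sum of the earlier functionals is the candidate [f]
    that [w n] refutes.  Let [v n] be almost maximal for [T] among the elements
    of the interval below a finite sum of [w k] with [n <= k], and [D n] the
    meet of [v 0], ..., [v n].  Then [g n] is large at [D n], which almost
    dominates [w n], and small at [D n.+1], which lies below a finite sum of
    later [w k].  So the decreasing sequence [D] contradicts
    [increments_null T]. *)
Lemma absolutely_continuous u (e : R) : 0 <=v u -> 0 < e ->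
  exists f (d : R), [/\ posfun f, 0 < d &
    forall w, 0 <=v w -> w <=v u -> f w <= d -> `|T w| <= e].
Proof.
move=> u0 e0; apply: contrapT => nac.
pose d i := e / 4 * h i.
have d0 i : 0 < d i by rewrite mulr_gt0// divr_gt0.
have sum_d n : \sum_(i < n) d i <= e / 4.
  by rewrite -mulr_sumr ler_piMr ?sum_h_lt1// ltW// divr_gt0.
pose good f i (wg : E * {linear E -> R^o}) := posfun f ->
  [/\ 0 <=v wg.1, wg.1 <=v u, f wg.1 <= d i & posfun wg.2] /\
  [/\ forall x, 0 <=v x -> wg.2 x <= `|T x| & e < wg.2 wg.1].
have /choice[G hG] : forall fi : {linear E -> R^o} * nat, exists wg,
    good fi.1 fi.2 wg.
  move=> [f i]; apply: contrapT => ng; apply: nac; exists f, (d i).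
  split=> // [|w w0 wu fw].
    apply: contrapT => nf; apply: ng; exists (0, f) => /= f0.
    by case: nf.
  rewrite leNgt; apply/negP => ew; apply: ng.
  have [g [g0 gT gw]] := norming_functional w0.
  exists (w, g) => _; split; split=> //=; exact: lt_le_trans gw.
pose f := fix f n : {linear E -> R^o} :=
  if n is m.+1 then (f m \+ (G (f m, m)).2)%R else \0.
pose w n := (G (f n, n)).1; pose g n := (G (f n, n)).2.
have fS n x : f n.+1 x = f n x + g n x by [].
have f0 n : posfun (f n).
  elim: n => [|n ih] x x0; first exact: lexx.
  rewrite fS addr_ge0 ?ih//.
  by case: (hG (f n, n) ih) => -[_ _ _ g0] _; exact: g0.
have w0 n : 0 <=v w n by case: (hG (f n, n) (f0 n)) => -[].
have wu n : w n <=v u by case: (hG (f n, n) (f0 n)) => -[].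
have fw n : f n (w n) <= d n by case: (hG (f n, n) (f0 n)) => -[].
have g0 n : posfun (g n) by case: (hG (f n, n) (f0 n)) => -[].
have gT n x : 0 <=v x -> g n x <= `|T x|.
  by case: (hG (f n, n) (f0 n)) => _ [+ _]; exact.
have gw n : e < g n (w n) by case: (hG (f n, n) (f0 n)) => _ [].
have gf i n x : (i < n)%N -> 0 <=v x -> g i x <= f n x.
  move=> + x0; elim: n => // n ih.
  rewrite ltnS leq_eqVlt => /predU1P[->|/ih le].
    by rewrite fS lerDr f0.
  by rewrite fS (le_trans le)// lerDl g0.
(* A join-closed set containing [w k] for [n <= k], on whose elements the
   earlier functionals remain small. *)
pose S n := [set x | [/\ 0 <=v x, x <=v u &
  exists M, x <=v \sum_(n <= i < M) w i]].
have Sw n k : (n <= k)%N -> S n (w k).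
  move=> nk; split=> //; exists k.+1; rewrite big_nat_recr//=.
  by rewrite vle_addl// vsum_ge0.
have Smono n M M' : (M <= M')%N ->
    \sum_(n <= i < M) w i <=v \sum_(n <= i < M') w i.
  move=> MM; have [nM|Mn] := leqP n M.
    by rewrite [X in _ <=v X](big_cat_nat (n := M))//= vle_addr// vsum_ge0.
  by rewrite big_geq ?vsum_ge0// ltnW.
have SJ n x y : S n x -> S n y -> S n (vjoin x y).
  move=> [x0 xu [M xM]] [y0 yu [M' yM]]; split.
  - by apply: vleT x0 (vjoinl _ _).
  - exact: vjoin_le.
  - exists (maxn M M'); apply: vjoin_le.
      by apply: vleT xM (Smono _ _ _ (leq_maxl _ _)).
    by apply: vleT yM (Smono _ _ _ (leq_maxr _ _)).
have /choice[v hv] : forall n, exists x, S n x /\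
    forall y, S n y -> `|T (vjoin x y - x)| <= d n.
  move=> n; have [|||x Sx xy] :=
    join_closed_almost_max incr (S := S n) (u := u) (d0 n).
  - by exists (w n); exact: Sw.
  - by move=> x [].
  - exact: SJ.
  by exists x.
have v0 n : 0 <=v v n by case: (hv n) => -[].
have vu n : v n <=v u by case: (hv n) => -[].
pose D := fix D n := if n is m.+1 then vmeet (D m) (v m.+1) else v 0%N.
have D0 n : 0 <=v D n by elim: n => //= n ih; exact: vmeet_ge.
have Du n : D n <=v u by elim: n => //= n ih; exact: vleT (vmeetl _ _) ih.
have wD k j : w k - \sum_(n < j.+1) (vjoin (v n) (w k) - v n) <=v D j.
  have le1 n : w k - (vjoin (v n) (w k) - v n) <=v v n.
    by rewrite vleBlDr addrC subrK vjoinr.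
  have ge0 n : 0 <=v vjoin (v n) (w k) - v n by rewrite vsub_ge0 vjoinl.
  elim: j => [|j ih]; first by rewrite big_ord1.
  rewrite big_ord_recr/=; apply: vmeet_ge.
    by apply: vleT _ ih; rewrite opprD addrA vle_subl.
  apply: vleT _ (le1 j.+1); rewrite opprD addrCA addrC vle_subl//.
  by apply: vsum_ge0.
have gD k : e - e / 4 <= g k (D k).
  apply: le_trans (posfun_le (g0 k) (wD k k)).
  rewrite raddfB lerB ?(ltW (gw k))// raddf_sum (le_trans _ (sum_d k.+1))//.
  apply: ler_sum => n _.
  rewrite (le_trans (gT _ _ _)) ?vsub_ge0 ?vjoinl//.
  by apply: (hv n).2; apply: Sw; rewrite -ltnS.
have gDS k : g k (D k.+1) <= e / 4.
  apply: le_trans (posfun_le (g0 k) (vmeetr _ _)) _.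
  case: (hv k.+1) => -[_ _ [M vM]] _.
  apply: le_trans (posfun_le (g0 k) vM) _; rewrite raddf_sum.
  apply: (@le_trans _ _ (\sum_(k.+1 <= i < M) d i)).
    rewrite big_nat_cond [leRHS]big_nat_cond.
    apply: ler_sum => i /andP[/andP[ki _] _].
    by apply: le_trans (fw i); exact: gf.
  rewrite (le_trans _ (sum_d M))// -(big_mkord xpredT d).
  have [kM|Mk] := leqP k.+1 M.
    rewrite (big_cat_nat (n := k.+1) (leq0n _) kM)//= lerDr.
    by apply: sumr_ge0 => i _; exact: ltW.
  rewrite [leLHS]big_geq; last exact: ltnW.
  by apply: sumr_ge0 => i _; exact: ltW.
have [|n|n|n|n] := @no_big_increments _ _ _ _ incr (fun n => u - D n) u (e / 4).
- by rewrite divr_gt0.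
- by rewrite vsub_ge0.
- by rewrite vle_subl.
- by rewrite vleD2lE vleN2 vmeetl.
have -> : u - D n.+1 - (u - D n) = D n - D n.+1.
  by rewrite opprB addrC addrA subrK.
rewrite leNgt => /negP; apply.
have d1 : 0 <=v D n - D n.+1 by rewrite vsub_ge0 vmeetl.
apply: lt_le_trans (gT n _ d1); rewrite raddfB.
have : e / 4 < (e - e / 4) - e / 4 by lra.
by move=> /lt_le_trans; apply; exact: lerB (gD n) (gDS n).
Qed.

End AbsoluteContinuity.

(** * Maximal convex filters *)

Section MidConvex.
Context {R : realType} {E : lmodType R}.
Implicit Types (C K : set E) (M G : set (set E)).

(** Convexity is used only through midpoints, where strictly convex functions
    have a definite defect. *)
Definition midconvex C :=
  forall x y : E, C x -> C y -> C (2^-1 *: (x + y)).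

Definition convex_base M :=
  [/\ M !=set0, forall C, M C -> midconvex C, forall C, M C -> C !=set0 &
      forall C K, M C -> M K -> M (C `&` K)].

(** The base of a maximal convex filter: only a subset of [K] is required to
    belong to [M], because [M] need not be upward closed. *)
Definition convex_ultra M := convex_base M /\
  forall K, midconvex K -> (forall C, M C -> C `&` K !=set0) ->
    exists2 C, M C & C `<=` K.

Lemma midconvexI C K : midconvex C -> midconvex K -> midconvex (C `&` K).
Proof.
by move=> mC mK x y [Cx Kx] [Cy Ky]; split; [exact: mC|exact: mK].
Qed.

Lemma convex_ultra_exists G : convex_base G ->
  exists2 M, convex_ultra M & G `<=` M.
Proof.
move=> [[C0 GC0] Gc G0 GI].
pose P M := [/\ forall C, M C -> midconvex C, forall C, M C -> C !=set0,
  forall C K, M C -> M K -> M (C `&` K) & M !=set0 -> G `<=` M].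
have [Fm FmP tot|M [[Mc M0 MI MG] Mmax]] := @Zorn_bigcup (set E) P.
  split=> [C [X FX XC]|C [X FX XC]|C K [X FX XC] [Y FY YK]|[C [X FX XC]] D GD].
  - by case: (FmP X FX) => + _ _ _; exact.
  - by case: (FmP X FX) => _ + _ _; exact.
  - have [XY|YX] := tot X Y FX FY.
      by exists Y => //; case: (FmP Y FY) => _ _ + _; apply => //; exact: XY.
    by exists X => //; case: (FmP X FX) => _ _ + _; apply => //; exact: YX.
  - by exists X => //; case: (FmP X FX) => _ _ _; apply => //; exists C.
have Mne : M !=set0.
  apply: contrapT => Me; apply: (Mmax G); last by split=> // _ C.
  split; first by move=> C MC; case: Me; exists C.
  by move=> /(_ _ GC0) MC; apply: Me; exists C0.
have {}MG := MG Mne.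
exists M => //; split=> // K mK MK.
apply: contrapT => nK.
pose M' := [set X | M X \/ exists2 C, M C & X = C `&` K].
have [C1 MC1] := Mne.
apply: (Mmax M'); first split.
- by move=> C MC; left.
- move=> M'M; apply: nK; exists (C1 `&` K); last exact: subIsetr.
  by apply: M'M; right; exists C1.
split.
- by move=> C [/Mc//|[D MD ->]]; apply: midconvexI => //; exact: Mc.
- by move=> C [/M0//|[D MD ->]]; exact: MK.
- move=> C D [MC|[C' MC ->]] [MD|[D' MD ->]].
  + by left; exact: MI.
  + by right; exists (C `&` D'); [exact: MI|rewrite setIA].
  + by right; exists (C' `&` D); [exact: MI|rewrite setIAC].
  + by right; exists (C' `&` D'); [exact: MI|rewrite setIACA setIid].
- by move=> _ C GC; left; exact: MG.
Qed.

(** Let [inf S] be the level from which on the sublevel sets of [f] contain a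
    member of [M].  Just below it, maximality yields a member avoiding the
    sublevel set. *)
Lemma convex_ultra_osc M (f : E -> R) (C0 : set E) (b eta : R) :
  convex_ultra M -> (forall c, midconvex [set x | f x <= c]) ->
  (forall x, 0 <= f x) -> M C0 -> (forall x, C0 x -> f x <= b) -> 0 < eta ->
  exists2 C, M C & forall x y, C x -> C y -> f x <= f y + eta.
Proof.
move=> [[_ Mc M0 MI] Mmax] qf f0 MC0 C0b eta0.
pose S := [set c | exists2 C, M C & forall x, C x -> f x <= c].
have hS : has_inf S.
  split; first by exists b, C0.
  exists 0 => c [C /M0[x Cx] /(_ x Cx)]; exact: le_trans.
have [c [C1 MC1 C1c] cS] := inf_adherent (divr_gt0 eta0 (ltr0n _ 2)) hS.
have [C2 MC2 C2f] : exists2 C2, M C2 & forall x, C2 x -> inf S - eta / 2 < f x.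
  apply: contrapT => h.
  have [|C MC Cf] := Mmax _ (qf (inf S - eta / 2)).
    move=> C MC; apply: contrapT => nC; apply: h; exists C => // x Cx.
    by rewrite ltNge; apply/negP => fx; apply: nC; exists x.
  have : inf S <= inf S - eta / 2 by apply: ge_inf; [exact: hS.2|exists C].
  by apply/negP; rewrite -ltNge; lra.
exists (C1 `&` C2); first exact: MI.
by move=> x y [/C1c fx _] [_ /C2f fy]; lra.
Qed.

End MidConvex.

(** * Images of maximal convex filters *)

Section ConvexUltraOperator.
Context {R : realType} {E F : banachLatticeType R}.
Variables (T : {linear E -> F}) (T0 : positive_operator T).
Implicit Types (x y u w : E) (M : set (set E)).

(** Let [g] sum the distances to the levels of a grid.  For [x] and [y] in a set
    stable under midpoints on which [f \o g] oscillates little, the defects of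
    midpoint convexity of all these distances are small under [f]; by
    [level_grid] they bound [modulus (x - y)] up to the mesh [v *+ 2]. *)
Lemma convex_ultra_functional M (f : {linear E -> R^o}) u C0 (d : R) :
  convex_ultra M -> posfun f -> 0 <=v u -> M C0 ->
  (forall x, C0 x -> modulus x <=v u) -> 0 < d ->
  exists2 C, M C & forall x y, C x -> C y -> f (modulus (x - y)) <= d.
Proof.
move=> uM f0 u0 MC0 C0u d0; have [[_ _ _ MI] _] := uM.
have [N hN] : exists N : nat, f (u *+ 4) <= N.+1%:R * (d / 2).
  exists (Num.truncn (f (u *+ 4) / (d / 2))).
  by rewrite -ler_pdivrMr ?divr_gt0// ltW// truncnS_gt.
pose v := N.+1%:R^-1 *: (u *+ 2).
have vN : v *+ N.+1 = u *+ 2.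
  by rewrite /v -[LHS]scaler_nat scalerA mulfV ?scale1r// pnatr_eq0.
have v0 : 0 <=v v by rewrite vscale_ge0 ?invr_ge0 ?ler0n// vmuln_ge0.
have fv : f (v *+ 2) <= d / 2.
  by rewrite /v scalerMnr -mulrnA linearZ /= ler_pdivrMl ?ltr0n.
(* The levels [v *+ j - u] cover the interval from [- u] to [u]. *)
pose g x := \sum_(j < N.+2) modulus (x + u - v *+ j).
have g0 x : 0 <=v g x by apply: vsum_ge0 => j _; exact: mod_ge0.
have mid x y j : modulus (2^-1 *: (x + y) + u - v *+ j) *+ 2 =
    modulus (x + y + u *+ 2 - v *+ 2 *+ j).
  rewrite -mod_mul2; congr modulus.
  rewrite mulrnBl mulrnDl mulrnAC; congr (_ + _ - _).
  by rewrite mulr2n -scalerDl -div1r -splitr scale1r.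
have gmid x y : g (2^-1 *: (x + y)) *+ 2 <=v g x + g y.
  rewrite /g -sumrMnl -big_split /=; apply: vle_sum => j _.
  rewrite mid; apply: vleT _ (mod_D _ _).
  suff -> : x + y + u *+ 2 - v *+ 2 *+ j = x + u - v *+ j + (y + u - v *+ j).
    exact: vlexx.
  by rewrite [RHS]addrACA [x + u + _]addrACA -opprD -!mulr2n mulrnAC.
have fM z : f (z *+ 2) = f z *+ 2 by rewrite !mulr2n raddfD.
have fgmid x y : f (g (2^-1 *: (x + y))) *+ 2 <= f (g x) + f (g y).
  by have := posfun_le f0 (gmid x y); rewrite fM (raddfD f).
have [|||||C MC Cosc] := @convex_ultra_osc _ _ M (fun x => f (g x)) C0
    (f (\sum_(j < N.+2) (u + u + v *+ j))) (d / 4) uM.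
- move=> c x y /= fx fy; have := fgmid x y; rewrite mulr2n; lra.
- by move=> x; exact: f0.
- exact: MC0.
- move=> x /C0u xu; apply: posfun_le f0 _; apply: vle_sum => j _.
  apply: vleT (mod_B _ _) _; rewrite (mod_id (vmuln_ge0 _ v0)) vleD2rE.
  by apply: vleT (mod_D _ _) _; rewrite (mod_id u0) vleD2rE.
- by rewrite divr_gt0.
exists (C `&` C0); first exact: MI.
move=> x y [Cx /C0u xu] [Cy /C0u yu].
have gap : modulus (x - y) <=v v *+ 2 + (g x + g y - g (2^-1 *: (x + y)) *+ 2).
  pose s := x + y + u *+ 2.
  apply: (vleT (v *+ 2 +
      \sum_(j < N.+2) vpos (modulus (x - y) - modulus (s - v *+ 2 *+ j)))).
    have sE : s = (x + u) + (y + u) by rewrite addrACA -mulr2n.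
    rewrite mod_itv in xu; rewrite mod_itv in yu.
    have [/andP[xu1 xu2] /andP[yu1 yu2]] := (xu, yu).
    apply: level_grid; first exact: vmuln_ge0.
      by rewrite sE vaddr_ge0// -[u]opprK vsub_ge0.
    by rewrite mulrnAC vN sE mulr2n vleD// mulr2n vleD2rE.
  rewrite vleD2lE /g -sumrMnl -big_split -sumrB /=; apply: vle_sum => j _.
  rewrite mid; have := midpoint_gap (x + u) (y + u) (v *+ j).
  by rewrite mulrnAC /s opprD addrACA subrr addr0 addrACA -mulr2n.
have := posfun_le f0 gap; rewrite (raddfD f) (raddfB f) /= !fM (raddfD f).
have := Cosc x (2^-1 *: (x + y)) Cx; have := Cosc y (2^-1 *: (x + y)) Cy.
have [[_ Mc _ _] _] := uM.
have Cz : C (2^-1 *: (x + y)) by exact: Mc.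
by move=> /(_ Cz) h1 /(_ Cz) h2; move: fv; rewrite fM /=; lra.
Qed.

Hypothesis incr : increments_null T.

Lemma convex_ultra_interval M u C0 (e : R) :
  convex_ultra M -> 0 <=v u -> M C0 -> (forall x, C0 x -> modulus x <=v u) ->
  0 < e -> exists2 C, M C & forall x y, C x -> C y -> `|T (x - y)| <= e.
Proof.
move=> uM u0 MC0 C0u e0; have [[_ _ _ MI] _] := uM.
have [f [d [f0 d0 fd]]] :=
  absolutely_continuous T0 incr (vaddr_ge0 u0 u0) e0.
have [C MC Cd] := convex_ultra_functional uM f0 u0 MC0 C0u d0.
exists (C `&` C0); first exact: MI.
move=> x y [Cx /C0u xu] [Cy /C0u yu].
apply: le_trans (norm_pos_mod T0 (vlexx _)) _.
apply: fd (mod_ge0 _) _ (Cd _ _ Cx Cy).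
by apply: vleT (mod_B _ _) _; exact: vleD.
Qed.

(** Fattened by [r], the members of [M] meet the order interval of [u] in
    convex sets.  A maximal convex filter that contains these has a member [D]
    with small image, by [convex_ultra_interval].  The points whose image is
    close to that of a fixed [d0] in [D] form a convex set meeting every member
    of [M], hence containing one. *)
Lemma convex_ultra_cauchy M (e : R) : convex_ultra M ->
  (forall r : R, 0 < r -> exists2 u, 0 <=v u & exists2 C, M C & forall x, C x ->
     exists2 z, modulus z <=v u & `|x - z| <= r) ->
  0 < e -> exists2 C, M C & forall x y, C x -> C y -> `|T (x - y)| <= e.
Proof.
move=> uM Maob e0; have [[[C1 MC1] Mc M0 MI] Mmax] := uM.
have [b b0 Tb] := pos_bounded T0.
pose r := e / 4 / b; have r0 : 0 < r by rewrite !divr_gt0.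
have [u u0 [Cu MCu Cuu]] := Maob r r0.
pose G := [set D : set E | midconvex D /\ exists2 C, M C & forall c z, C c ->
  modulus z <=v u -> `|c - z| <= r -> D z].
pose I := [set z | modulus z <=v u].
have cI : midconvex I by move=> x y; exact: mod_midpoint.
have GB : convex_base G.
  split.
  - by exists setT; split => //; exists C1.
  - by move=> D [].
  - move=> D [_ [C MC CD]]; have [x [Cx Cux]] := M0 _ (MI _ _ MC MCu).
    by have [z zu xz] := Cuu x Cux; exists z; exact: CD xz.
  - move=> D D' [mD [C MC CD]] [mD' [C' MC' CD']]; split.
      exact: midconvexI.
    exists (C `&` C'); first exact: MI.
    by move=> c z [Cc Cc'] zu cz; split; [exact: CD cz|exact: CD' cz].
have [M' uM' GM'] := convex_ultra_exists GB.
have M'I : M' I by apply: GM'; split => //; exists C1.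
have e4 : 0 < e / 4 by rewrite divr_gt0.
have [D M'D De] := convex_ultra_interval uM' u0 M'I (fun=> id) e4.
have [[_ _ M'0 M'I2] _] := uM'.
have [d0 Dd0] := M'0 _ M'D.
pose K := [set x | `|T (x - d0)| <= e / 2].
have mK : midconvex K.
  move=> x y; rewrite /K/= => xK yK.
  have -> : 2^-1 *: (x + y) - d0 = 2^-1 *: ((x - d0) + (y - d0)).
    by rewrite addrACA -opprD scalerBr midpointxx.
  rewrite linearZ normrZ gtr0_norm ?invr_gt0// raddfD ler_pdivrMl//.
  by rewrite (le_trans (ler_normD _ _))//; lra.
have [C MC|C MC CK] := Mmax K mK.
  pose D' := [set z | exists c, [/\ C c, modulus z <=v u & `|c - z| <= r]].
  have GD' : G D'.
    split; last by exists C => // c z Cc zu cz; exists c.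
    move=> x y [c [Cc xu cx]] [c' [Cc' yu cy]].
    exists (2^-1 *: (c + c')); split; [exact: (Mc C)|exact: cI|].
    rewrite -scalerBr opprD addrACA normrZ gtr0_norm ?invr_gt0// ler_pdivrMl//.
    by rewrite (le_trans (ler_normD _ _))//; lra.
  have [z [Dz [c [Cc zu cz]]]] := M'0 _ (M'I2 _ _ M'D (GM' _ GD')).
  exists c; split => //; rewrite /K/=.
  have -> : c - d0 = (c - z) + (z - d0) by rewrite addrA subrK.
  rewrite raddfD (le_trans (ler_normD _ _))//.
  have := De _ _ Dz Dd0; have := Tb (c - z).
  have : b * `|c - z| <= e / 4.
    apply: (@le_trans _ _ (b * r)); first by rewrite ler_pM2l.
    by rewrite /r mulrC divfK// gt_eqF.
  lra.
exists C => // x y /CK xK /CK yK; rewrite /K/= in xK yK.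
have -> : x - y = (x - d0) - (y - d0) by rewrite opprB addrA subrK.
rewrite raddfB (le_trans (ler_normB _ _))//; lra.
Qed.

End ConvexUltraOperator.

(** * The weak topology *)

Section WeakTopology.
Context {R : realType} {V : normedModType R}.
Implicit Types (f : {linear V -> R^o}).

Lemma weak_open_preimage f (B : set R) : continuous f -> open B ->
  open (f @^-1` B : set (weak V)).
Proof.
move=> cf Bo; rewrite openE => x Bfx.
pose i : {f : {linear V -> R^o} | continuous f} := exist _ f cf.
pose Tc (g : {f : {linear V -> R^o} | continuous f}) :=
  Topological.on (initial_topology (sval g : V -> R^o)).
have h := (@cvg_sup V _ Tc (nbhs (x : weak V)) x _).1 (@cvg_id _ _) i.
apply: (h _ (f @^-1` B)).
apply: (@open_nbhs_nbhs (initial_topology (f : V -> R^o))).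
by split=> //; exists B.
Qed.

Lemma weak_cvg (G : set_system V) (y : V) : Filter G ->
  (forall f (eta : R), continuous f -> 0 < eta ->
     G [set z | f z < f y + eta]) ->
  G --> (y : weak V).
Proof.
move=> FG Gf; apply/cvg_sup => -[f cf] S /=.
move=> [_ [[B Bo <-] Bfy sBS]].
apply: filterS sBS _.
have [eta /= eta0 etaB] : nbhs_ball (f y) B.
  by rewrite nbhs_ballE; exact: open_nbhs_nbhs.
have cNf : continuous (\- f) by move=> x; apply: cvgN; exact: cf.
have G1 := Gf _ _ cf eta0; have G2 := Gf (\- f)%R _ cNf eta0.
apply: filterS (filterI G1 G2) => z [/= z1 z2]; apply: etaB.
rewrite /ball/= ltr_norml; apply/andP; split; lra.
Qed.

Lemma continuous_le_norm f : (forall x, f x <= `|x|) -> continuous f.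
Proof.
move=> fn; apply: bounded_linear_continuous; apply/linear_boundedP.
near=> r => x.
have r1 : 1 <= r by near: r; exact: nbhs_pinfty_ge.
apply: (@le_trans _ _ `|x|); last by rewrite ler_peMl.
by rewrite ler_norml fn andbT lerNl -raddfN -(normrN x) fn.
Unshelve. all: by end_near. Qed.

End WeakTopology.

(** Let [y] be a weak cluster point.  If [y] were at distance at least [r] from
    the convex set of all [c] with [a N <=v c <=v a n] for some [n], a
    continuous functional would separate it from the tail of [a].  So there are
    [c <=v a M] and [c'] above [a n.+1] that are both close to [y], and the
    increments of [a] beyond [M] lie below [c' - c]. *)
Lemma weakly_compact_increasing (R : realType) (F : banachLatticeType R)
    (A : set F) (a : nat -> F) :
  relatively_weakly_compact A -> (forall n, A (a n)) ->
  (forall n, a n <=v a n.+1) ->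
  forall e : R, 0 < e -> exists N, forall n, (N <= n)%N ->
    `|a n.+1 - a n| <= e.
Proof.
move=> cA Aa aS e e0.
have mono := vle_incr aS.
have [|y [_ ycl]] := cA (a @ \oo).
  by exists 0%N => // n _; apply: subset_closure; exact: Aa.
have near_y N (r : R) : 0 < r -> exists c n,
    [/\ a N <=v c, c <=v a n & `|y - c| <= r].
  move=> r0; apply: contrapT => h.
  pose D := [set z | exists c n, [/\ a N <=v c, c <=v a n & z = y - c]].
  have sn : sublinear (fun x : F => `|x|).
    split=> [x z|b x b0]; first exact: ler_normD.
    by rewrite normrZ ger0_norm.
  have cD : vconvex D.
    move=> _ _ s t s0 t0 st [c [n [Nc cn ->]]] [d [m [Nd dm ->]]].
    exists (s *: c + t *: d), (maxn n m); split.
    - by rewrite -[a N]scale1r -st scalerDl vleD ?vle_scale.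
    - rewrite -[a _]scale1r -st scalerDl vleD ?vle_scale//.
        by apply: vleT cn (mono _ _ (leq_maxl _ _)).
      by apply: vleT dm (mono _ _ (leq_maxr _ _)).
    - by rewrite !scalerBr addrACA -opprD -scalerDl st scale1r.
  have [||f [fn fD]] := mazur_orlicz (eps := r) sn cD.
  - by exists (y - a N), (a N), N; split=> //; exact: vlexx.
  - move=> _ [c [n [Nc cn ->]]]; apply/ltW; rewrite ltNge; apply/negP => yc.
    by apply: h; exists c, n.
  have cf := continuous_le_norm fn.
  have [||z [[n Nn <-] /= fz]] :=
    ycl [set z | exists2 n, (N <= n)%N & a n = z]
        (f @^-1` [set t | f y - r < t]).
  - by exists N => // n Nn; exists n.
  - apply: open_nbhs_nbhs; split; last by rewrite /=; lra.
    by apply: weak_open_preimage => //; exact: open_gt.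
  have Dn : D (y - a n).
    by exists (a n), n; split=> //; [exact: mono|exact: vlexx].
  have := fD _ Dn; rewrite raddfB /=.
  by apply/negP; rewrite -ltNge; lra.
have [c [M [_ cM yc]]] := near_y 0%N (e / 2) (divr_gt0 e0 (ltr0n _ 2)).
exists M => n Mn.
have [c' [_ [nc' _ yc']]] := near_y n.+1 (e / 2) (divr_gt0 e0 (ltr0n _ 2)).
apply: (@le_trans _ _ `|c' - c|).
  rewrite norm_mono ?vsub_ge0// vleD// vleN2.
  by apply: vleT cM (mono _ _ Mn).
have -> : c' - c = (y - c) - (y - c') by rewrite opprB [RHS]addrC addrA subrK.
by rewrite (le_trans (ler_normB _ _))//; lra.
Qed.

(** * Weak compactness of images *)

Section RelativelyWeaklyCompact.
Context {R : realType} {E F : banachLatticeType R}.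
Variables (T : {linear E -> F}) (T0 : positive_operator T).
Hypothesis incr : increments_null T.

Lemma aob_split (A : set E) : almost_order_bounded A ->
  forall r : R, 0 < r -> exists2 u, 0 <=v u & forall x, A x ->
    exists2 z, modulus z <=v u & `|x - z| <= r.
Proof.
move=> aA r r0; have [u u0 Au] := aA r r0.
exists u => // x /Au[z /= zu [b /= b1 <-]]; exists z; first by rewrite mod_itv.
by rewrite addrC addKr normrZ gtr0_norm// ler_piMr// ltW.
Qed.

(** Only weakly open members of [W] are pulled back, as [W] lives on the closure
    of [T @` A], where a general member can miss [T @` A]. *)
Lemma aob_image_weakly_compact (A : set E) : almost_order_bounded A ->
  relatively_weakly_compact (T @` A).
Proof.
move=> /aob_split aA; rewrite /relatively_weakly_compact compact_ultra.
move=> W uW Wcl.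
pose G := [set C : set E | midconvex C /\ exists U : set (weak F),
  [/\ open U, W U & forall x, A x -> U (T x) -> C x]].
have GB : convex_base G.
  split.
  - exists setT; split=> //; exists setT.
    by split=> //; [exact: openT|exact: filterT].
  - by move=> C [].
  - move=> C [_ [U [Uo WU UC]]].
    have [z [zcl Uz]] := filter_ex (filterI Wcl WU).
    have [_ [[x Ax <-] UTx]] := zcl U (open_nbhs_nbhs (conj Uo Uz)).
    by exists x; exact: UC.
  - move=> C C' [mC [U [Uo WU UC]]] [mC' [U' [U'o WU' UC']]]; split.
      exact: midconvexI.
    exists (U `&` U'); split; [exact: openI|exact: filterI|].
    by move=> x Ax [Ux U'x]; split; [exact: UC|exact: UC'].
have [M uM GM] := convex_ultra_exists GB.
have [[Mne Mc M0 MI] _] := uM.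
have Tcauchy (e : R) : 0 < e -> exists2 C, M C &
    forall x y, C x -> C y -> `|T (x - y)| <= e.
  apply: convex_ultra_cauchy => // r r0; have [u u0 Au] := aA r r0.
  exists u => //.
  exists [set x | exists2 z, modulus z <=v u & `|x - z| <= r] => //.
  apply: GM; split; last first.
    by exists setT; split; [exact: openT|exact: filterT|move=> x /Au].
  move=> x y [z zu xz] [z' zu' yz]; exists (2^-1 *: (z + z')).
    exact: mod_midpoint.
  rewrite -scalerBr opprD addrACA normrZ gtr0_norm ?invr_gt0// ler_pdivrMl//.
  by rewrite (le_trans (ler_normD _ _))//; lra.
pose H : set_system F := filter_from M (fun C => T @` C).
have FH : ProperFilter H.
  apply: filter_from_proper; last by move=> C /M0[x Cx]; exists (T x), x.
  apply: filter_from_filter => // C D MC MD; exists (C `&` D); first exact: MI.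
  by move=> _ [x [Cx Dx] <-]; split; exists x.
have Hy : cvg H.
  apply: cauchy_cvg; apply: cauchy_exP => e e0.
  have [C MC Ce] := Tcauchy (e / 2) (divr_gt0 e0 (ltr0n _ 2)).
  have [x Cx] := M0 C MC; exists (T x), C => // _ [z Cz <-].
  rewrite -ball_normE /= -raddfB (le_lt_trans (Ce _ _ Cx Cz))//; lra.
set y := lim H in Hy.
have Wy : W --> (y : weak F).
  apply: weak_cvg => f eta cf eta0.
  have [//|Wn] := in_ultra_setVsetC [set z | f z < f y + eta] uW.
  pose U := f @^-1` [set t | f y + eta / 2 < t].
  have Uo : open (U : set (weak F)).
    by apply: weak_open_preimage => //; exact: open_gt.
  have GU : G [set x | U (T x)].
    split.
      move=> x z; rewrite /U /= => fx fz.
      have -> : f (T (2^-1 *: (x + z))) = 2^-1 * (f (T x) + f (T z)).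
        by rewrite linearZ raddfD [LHS]linearZ /= [in LHS]raddfD.
      rewrite ltr_pdivlMl//; lra.
    exists U; split => //; apply: filterS Wn => z /negP.
    by rewrite -leNgt /U/=; lra.
  have : H (f @^-1` [set t | t < f y + eta / 2]).
    apply: Hy; apply: cf; apply: open_nbhs_nbhs; split; first exact: open_lt.
    by rewrite /=; lra.
  move=> [C MC Cf].
  have [x [Ux Cx]] := M0 _ (MI _ _ (GM _ GU) MC).
  have /= := Cf (T x) (imageP T Cx); rewrite /U/= in Ux.
  by move=> h; have := lt_trans h Ux; rewrite ltxx.
exists y; split => // B /nbhs_interior Bo.
have [w [wcl Bw]] := filter_ex (filterI Wcl (Wy _ Bo)).
exact: wcl.
Qed.

End RelativelyWeaklyCompact.

(** * The characterisation *)

Section Characterisation.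
Context {R : realType} {E F : banachLatticeType R}.
Variables (T : {linear E -> F}) (T0 : positive_operator T).

Lemma order_interval_aob (A : set E) u : 0 <=v u ->
  (forall x, A x -> modulus x <=v u) -> almost_order_bounded A.
Proof.
move=> u0 Au e e0; exists u => // x /Au xu.
exists x; first by rewrite /= -mod_itv.
by exists 0; rewrite /= ?normr0 ?scaler0 ?addr0.
Qed.

Lemma pos_continuous : continuous T.
Proof.
have [M M0 TM] := pos_bounded T0.
apply: bounded_linear_continuous; apply/linear_boundedP.
near=> r => x.
have Mr : M <= r by near: r; apply: nbhs_pinfty_ge; exact: num_real.
by apply: le_trans (TM x) _; rewrite ler_wpM2r.
Unshelve. all: by end_near. Qed.

Lemma increments_null_interval :
  (forall u, 0 <=v u ->
     relatively_weakly_compact (T @` [set x | modulus x <=v u])) ->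
  increments_null T.
Proof.
move=> cT x u x0 xu xS.
have u0 : 0 <=v u by exact: vleT (x0 0%N) (xu 0%N).
apply/cvgrPdist_le => e e0.
have [||N hN] := weakly_compact_increasing (cT u u0) (a := T \o x) _ _ e0.
- by move=> n; exists (x n) => //=; rewrite mod_id.
- by move=> n; exact: pos_le.
exists N => // n /hN /=; by rewrite sub0r normrN normr_id -raddfB.
Qed.

(** Sums of disjoint elements are joins, so the partial sums stay below [u]. *)
Lemma disjoint_null_of_increments : increments_null T -> disjoint_null T.
Proof.
move=> incr y u y0 yu yd.
pose s n := \sum_(i < n) y i.
have sS n : s n.+1 = s n + y n by rewrite /s big_ord_recr.
have s0 n : 0 <=v s n by apply: vsum_ge0.
have sd n m : (n <= m)%N -> vmeet (s n) (y m) = 0.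
  elim: n => [|n ih] nm.
    rewrite /s big_ord0; apply: vle_eq; first exact: vmeetl.
    by apply: vmeet_ge => //; exact: vlexx.
  by rewrite sS vmeetD_eq0 ?ih ?yd// ltnW.
have su n : s n <=v u.
  elim: n => [|n ih]; first by rewrite /s big_ord0 (vleT (y 0%N)).
  by rewrite sS -vjoin_add ?sd//; exact: vjoin_le.
have := incr s u s0 su; rewrite (_ : (fun n => _) = fun n => `|T (y n)|).
  by apply=> n; rewrite sS vle_addr.
by apply/funext => n; rewrite sS addrAC subrr add0r.
Qed.

(** The modulus of [x n] is at most a term of a disjoint sequence below [u] plus
    an element of small norm. *)
Lemma disjoint_seq_aob_null (x : nat -> E) : disjoint_null T ->
  disjoint_seq x -> almost_order_bounded (range x) ->
  (fun n => `|T (x n)|) @ \oo --> (0 : R).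
Proof.
move=> dn dx /aob_split xaob.
apply/cvgrPdist_le => e e0.
have [M M0 TM] := pos_bounded T0.
have [u u0 xu] := xaob (e / 2 / M) (divr_gt0 (divr_gt0 e0 (ltr0n _ 2)) M0).
pose z n := vmeet (modulus (x n)) u.
have z0 n : 0 <=v z n by apply: vmeet_ge => //; exact: mod_ge0.
have cz : (fun n => `|T (z n)|) @ \oo --> (0 : R).
  apply: (dn z u) => // [n|n m nm]; first exact: vmeetr.
  apply: (vmeet0_le (z0 n) (z0 m) (vmeetl _ _) (vmeetl _ _)).
  by rewrite dx ?ltn_eqF.
have [N _ hN] := (cvgrPdist_le _ _).1 cz (e / 2) (divr_gt0 e0 (ltr0n _ 2)).
exists N => // n /hN; rewrite !sub0r !normrN !normr_id => zn.
have [w wu xw] := xu (x n) (imageT x n).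
have le1 : modulus (x n) <=v z n + modulus (x n - w).
  rewrite -vleBlDr; apply: vmeet_ge; first by rewrite vle_subl ?mod_ge0.
  rewrite vleBlDr (vleT (modulus w + modulus (x n - w)))//.
    by rewrite -{1}[x n](subrK w) addrC mod_D.
  by rewrite vleD2rE.
apply: le_trans (norm_pos_mod T0 le1) _; rewrite raddfD.
rewrite (le_trans (ler_normD _ _))// [leRHS]splitr lerD//.
rewrite (le_trans (TM _))// norm_mod mulrC -ler_pdivlMr//.
Qed.

End Characterisation.

Theorem theorem4 (R : realType) (E F : banachLatticeType R)
    (hF : dedekind_complete F) (T : {linear E -> F})
    (hT : positive_operator T) :
  almost_order_weakly_compact T <->
  (forall x : nat -> E, disjoint_seq x -> almost_order_bounded (range x) ->
     (fun n => `|T (x n)|) @ \oo --> (0 : R)).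
Proof.
split=> [[_ cT] x|dT].
  apply: disjoint_seq_aob_null => //; apply: disjoint_null_of_increments.
  apply: increments_null_interval => // u u0; apply: cT.
  exact: order_interval_aob u0 _.
split; first exact: pos_continuous.
move=> A; apply: aob_image_weakly_compact => //.
apply: disjoint_increments => // y u y0 yu yd.
have modE n : modulus (y n) = y n by exact: mod_id.
apply: dT.
  move=> n m nm; rewrite !modE; have [nm'|mn'|nm'] := ltngtP n m.
  - exact: yd.
  - by rewrite vmeetC yd.
  - by rewrite nm' eqxx in nm.
apply: (@order_interval_aob _ _ _ u); first exact: vleT (y0 0%N) (yu 0%N).
by move=> _ [n _ <-]; rewrite modE.
Qed.
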